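(* Let $k\in\mathbb{N}$, let $f_1,\ldots,f_k:\mathbb{N}\to\mathbb{C}$ be completely multiplicative arithmetic functions and let $F=f_1*\cdots*f_k$ (Dirichlet convolution). Let $\vartheta_F:\mathbb{N}^2\to\mathbb{C}$ be the multiplicative function of two variables defined, for every prime $p$ and every $\nu_1,\nu_2\in\mathbb{N}_0$, by \[ \vartheta_F(p^{\nu_1},p^{\nu_2})= \begin{cases} 1, & \nu_1=\nu_2=0,\\ (-1)^{\nu_1+\nu_2-1} e_{\nu_1+\nu_2}(f_1(p),\ldots,f_k(p)), & \nu_1,\nu_2\ge 1,\ \nu_1+\nu_2 \le k,\\ 0, & \text{otherwise}, \end{cases} \] where $e_d(x_1,\ldots,x_k)=\sum_{1\le i_1<\cdots<i_d\le k}x_{i_1}\cdots x_{i_d}$ is the elementary symmetric polynomial of degree $d$. Let $\vartheta_F^{-1_*}$ be the inverse of $\vartheta_F$ under the two-variable Dirichlet convolution. Then for every $n_1,n_2\in\mathbb{N}$, \[ F(n_1n_2) = \sum_{a_1\mid n_1, \, a_2\mid n_2} F\left(\frac{n_1}{a_1}\right) F \left(\frac{n_2}{a_2}\right)\vartheta_F(a_1,a_2), \] and \[ F(n_1) F(n_2) = \sum_{a_1\mid n_1, \, a_2\mid n_2} F\left(\frac{n_1n_2}{a_1a_2}\right) \vartheta_F^{-1_*}(a_1,a_2). \]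
   Context: $\mathbb{N}=\{1,2,\ldots\}$, $\mathbb{N}_0=\{0,1,2,\ldots\}$. For $G,H:\mathbb{N}^2\to\mathbb{C}$, the two-variable Dirichlet convolution is $(G*H)(n_1,n_2)=\sum_{a_1\mid n_1,a_2\mid n_2}G(a_1,a_2)H(n_1/a_1,n_2/a_2)$, with identity $\delta$ ($\delta(1,1)=1$, $\delta(n_1,n_2)=0$ if $n_1n_2>1$); $G$ has an inverse $G^{-1_*}$ iff $G(1,1)\ne0$. A function $G:\mathbb{N}^2\to\mathbb{C}$ is multiplicative if it is not identically zero and $G(m_1n_1,m_2n_2)=G(m_1,m_2)G(n_1,n_2)$ whenever $\gcd(m_1m_2,n_1n_2)=1$; it then satisfies $G(n_1,n_2)=\prod_p G(p^{\nu_p(n_1)},p^{\nu_p(n_2)})$ and is determined by its values on pairs of powers of the same prime. By convention $e_0=1$ and $e_d=0$ for $d>k$. *)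

(* Defs.v *)
From HB Require Import structures.
From mathcomp Require Import all_boot all_order all_algebra.
From mathcomp Require Import reals complex mpoly.

Set Implicit Arguments.
Unset Strict Implicit.
Unset Printing Implicit Defensive.

Import GRing.Theory.
Local Open Scope ring_scope.

(* An arithmetic function of one or two variables is a function on nat of which
   only the values at positive arguments matter: every hypothesis and
   conclusion below is restricted to positive arguments, and a divisor of a
   positive number is positive. *)
Section Definitions.

Variable K : fieldType.

Definition completely_multiplicative (f : nat -> K) : Prop :=
  (exists2 n, (0 < n)%N & f n != 0) /\
  (forall m n, (0 < m)%N -> (0 < n)%N -> f (m * n)%N = f m * f n).

Definition dconv (f g : nat -> K) (n : nat) : K :=
  \sum_(d <- divisors n) f d * g (n %/ d)%N.

Definition ddelta (n : nat) : K := (n == 1%N)%:R.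

(* f_1 * (f_2 * ( ... * (f_k * ddelta))), where ddelta is the unit of dconv. *)
Definition dconv_fam (k : nat) (f : 'I_k -> nat -> K) : nat -> K :=
  \big[dconv/ddelta]_(i < k) f i.

Definition multiplicative2 (G : nat -> nat -> K) : Prop :=
  (exists n1 n2, [/\ (0 < n1)%N, (0 < n2)%N & G n1 n2 != 0]) /\
  (forall m1 m2 n1 n2, (0 < m1)%N -> (0 < m2)%N -> (0 < n1)%N -> (0 < n2)%N ->
     coprime (m1 * m2) (n1 * n2) ->
     G (m1 * n1)%N (m2 * n2)%N = G m1 m2 * G n1 n2).

Definition dconv2 (G H : nat -> nat -> K) (n1 n2 : nat) : K :=
  \sum_(a1 <- divisors n1) \sum_(a2 <- divisors n2)
     G a1 a2 * H (n1 %/ a1)%N (n2 %/ a2)%N.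

Definition ddelta2 (n1 n2 : nat) : K := ((n1 == 1%N) && (n2 == 1%N))%:R.

Definition dinverse2 (G H : nat -> nat -> K) : Prop :=
  forall n1 n2, (0 < n1)%N -> (0 < n2)%N -> dconv2 G H n1 n2 = ddelta2 n1 n2.

Definition vartheta_pp (k : nat) (f : 'I_k -> nat -> K) (p v1 v2 : nat) : K :=
  if (v1 == 0%N) && (v2 == 0%N) then 1
  else if [&& (1 <= v1)%N, (1 <= v2)%N & (v1 + v2 <= k)%N]
  then (-1) ^+ (v1 + v2 - 1) * (mesym k K (v1 + v2)).@[fun i => f i p]
  else 0.

Definition is_vartheta (k : nat) (f : 'I_k -> nat -> K)
    (theta : nat -> nat -> K) : Prop :=
  multiplicative2 theta /\
  (forall p v1 v2, prime p -> theta (p ^ v1)%N (p ^ v2)%N = vartheta_pp f p v1 v2).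

End Definitions.

(* is_vartheta and dinverse2 each determine their last argument on positive
   pairs; the lemmas below show that they are satisfiable. *)
Section Existence.

Variable K : fieldType.

Section Euler.

Variable L : nat -> nat -> nat -> K.
Hypothesis L0 : forall p, L p 0 0 = 1.

Let euler2 n1 n2 : K :=
  \prod_(p < (n1 * n2).+1 | prime p) L p (logn p n1) (logn p n2).

Let euler2_widen N n1 n2 : (0 < n1)%N -> (0 < n2)%N -> (n1 * n2 < N)%N ->
  euler2 n1 n2 = \prod_(p < N | prime p) L p (logn p n1) (logn p n2).
Proof.
move=> n1_gt0 n2_gt0 ltN; rewrite /euler2.
rewrite (big_ord_widen_cond N prime (fun p => L p (logn p n1) (logn p n2))) //.
rewrite [RHS](bigID (fun p : 'I_N => (p < (n1 * n2).+1)%N)) /=.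
rewrite [X in _ * X]big1 ?mulr1 // => p /andP[pp]; rewrite -leqNgt => ltp.
have n12_gt0 : (0 < n1 * n2)%N by rewrite muln_gt0 n1_gt0.
rewrite !ltn_log0 ?L0 //.
  by apply: leq_ltn_trans ltp; rewrite leq_pmull.
by apply: leq_ltn_trans ltp; rewrite leq_pmulr.
Qed.

Let euler2_mult : multiplicative2 euler2.
Proof.
split.
  exists 1%N, 1%N; split=> //; rewrite /euler2 big1 ?oner_neq0 // => p _.
  by rewrite logn1 L0.
move=> m1 m2 n1 n2 m1_gt0 m2_gt0 n1_gt0 n2_gt0 co.
pose N := (m1 * n1 * (m2 * n2) + m1 * m2 + n1 * n2).+1.
rewrite !(@euler2_widen N) ?muln_gt0 ?m1_gt0 ?m2_gt0 //; last 3 first.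
- by rewrite ltnS leq_addl.
- by rewrite ltnS addnAC leq_addl.
- by rewrite ltnS -addnA leq_addr.
rewrite -big_split /=; apply: eq_bigr => p pp.
rewrite !lognM //.
have [pm|pm] := boolP (p %| m1 * m2)%N.
  have : ~~ (p %| n1 * n2)%N.
    apply/negP => pn; have := dvdn_gcd p (m1 * m2) (n1 * n2).
    rewrite pm pn (eqP co) dvdn1 => /eqP p1; by rewrite p1 in pp.
  rewrite Euclid_dvdM // negb_or => /andP[h1 h2].
  have e1 : logn p n1 = 0%N by apply/eqP; rewrite eqn0Ngt logn_gt0 mem_primes pp n1_gt0.
  have e2 : logn p n2 = 0%N by apply/eqP; rewrite eqn0Ngt logn_gt0 mem_primes pp n2_gt0.
  by rewrite e1 e2 L0 !addn0 mulr1.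
move: pm; rewrite Euclid_dvdM // negb_or => /andP[h1 h2].
have e1 : logn p m1 = 0%N by apply/eqP; rewrite eqn0Ngt logn_gt0 mem_primes pp m1_gt0.
have e2 : logn p m2 = 0%N by apply/eqP; rewrite eqn0Ngt logn_gt0 mem_primes pp m2_gt0.
by rewrite e1 e2 L0 !add0n mul1r.
Qed.

Let euler2_pp p v1 v2 : prime p -> euler2 (p ^ v1)%N (p ^ v2)%N = L p v1 v2.
Proof.
move=> pp; have p0 := prime_gt0 pp.
pose N := (p + p ^ v1 * p ^ v2).+1.
have ltp : (p < N)%N by rewrite ltnS leq_addr.
rewrite (@euler2_widen N) ?expn_gt0 ?p0 ?ltnS ?leq_addl //.
rewrite (bigD1 (Ordinal ltp)) //= !pfactorK // big1 ?mulr1 // => q /andP[pq qp].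
suff e v : logn q (p ^ v) = 0%N by rewrite !e L0.
have /negPf qp' : nat_of_ord q != p by [].
by rewrite lognX logn_prime // qp' muln0.
Qed.

Lemma multiplicative2_exists : exists2 G : nat -> nat -> K,
  multiplicative2 G &
  forall p v1 v2, prime p -> G (p ^ v1)%N (p ^ v2)%N = L p v1 v2.
Proof. by exists euler2. Qed.

End Euler.

Lemma is_vartheta_exists (k : nat) (f : 'I_k -> nat -> K) :
  exists theta, is_vartheta f theta.
Proof. by have [//|G Gm Gpp] := @multiplicative2_exists (vartheta_pp f); exists G. Qed.

Lemma is_vartheta11 (k : nat) (f : 'I_k -> nat -> K) theta :
  is_vartheta f theta -> theta 1%N 1%N = 1.
Proof. by case=> _ /(_ 2%N 0%N 0%N erefl). Qed.

Lemma dinverse2_exists (G : nat -> nat -> K) :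
  G 1%N 1%N != 0 -> exists H, dinverse2 G H.
Proof.
move=> G11.
pose one2 a1 a2 := (a1 == 1%N) && (a2 == 1%N).
pose fix I (m n1 n2 : nat) {struct m} : K := if m is m'.+1 then
   (G 1%N 1%N)^-1 * (ddelta2 K n1 n2 -
      \sum_(a1 <- divisors n1) \sum_(a2 <- divisors n2)
        (if one2 a1 a2 then 0 else G a1 a2 * I m' (n1 %/ a1)%N (n2 %/ a2)%N))
  else 0.
have Ifuel m m' n1 n2 : (0 < n1)%N -> (0 < n2)%N ->
    (n1 + n2 <= m)%N -> (n1 + n2 <= m')%N -> I m n1 n2 = I m' n1 n2.
  elim: m m' n1 n2 => [|m IH] [|m'] n1 n2 n1_gt0 n2_gt0;
    rewrite ?leqn0 ?addn_eq0 ?(gtn_eqF n1_gt0) //= => le1 le2.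
  congr (_ * (_ - _)); apply: eq_big_seq => a1 a1d; apply: eq_big_seq => a2 a2d.
  case: ifPn => // no; congr (_ * _).
  move: a1d a2d; rewrite -!dvdn_divisors // => a1d a2d.
  have a1_gt0 := dvdn_gt0 n1_gt0 a1d; have a2_gt0 := dvdn_gt0 n2_gt0 a2d.
  have lt : (n1 %/ a1 + n2 %/ a2 < n1 + n2)%N.
    have l1 := leq_div n1 a1; have l2 := leq_div n2 a2.
    move: no; rewrite negb_and => /orP[] ne.
      by rewrite -addSn leq_add // ltn_Pdiv // ltn_neqAle eq_sym ne.
    by rewrite -addnS leq_add // ltn_Pdiv // ltn_neqAle eq_sym ne.
  apply: IH; rewrite ?divn_gt0 ?(dvdn_leq _ a1d) ?(dvdn_leq _ a2d) //.
    by rewrite -ltnS; apply: leq_trans le1.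
  by rewrite -ltnS; apply: leq_trans le2.
exists (fun n1 n2 => I (n1 + n2)%N n1 n2) => n1 n2 n1_gt0 n2_gt0.
rewrite /dconv2.
pose T a1 a2 := G a1 a2 * I (n1 + n2).-1 (n1 %/ a1)%N (n2 %/ a2)%N.
set H := fun n1 n2 => I (n1 + n2)%N n1 n2.
have main : \sum_(a1 <- divisors n1) \sum_(a2 <- divisors n2)
     G a1 a2 * H (n1 %/ a1)%N (n2 %/ a2)%N =
   \sum_(a1 <- divisors n1) \sum_(a2 <- divisors n2)
     ((if one2 a1 a2 then G 1%N 1%N * H n1 n2 else 0) +
      (if one2 a1 a2 then 0 else T a1 a2)).
  apply: eq_big_seq => a1 a1d; apply: eq_big_seq => a2 a2d.
  case: ifPn => [/andP[/eqP-> /eqP->]|no]; first by rewrite !divn1 addr0.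
  rewrite add0r /T /H; congr (_ * _).
  move: a1d a2d; rewrite -!dvdn_divisors // => a1d a2d.
  have a1_gt0 := dvdn_gt0 n1_gt0 a1d; have a2_gt0 := dvdn_gt0 n2_gt0 a2d.
  have lt : (n1 %/ a1 + n2 %/ a2 < n1 + n2)%N.
    have l1 := leq_div n1 a1; have l2 := leq_div n2 a2.
    move: no; rewrite negb_and => /orP[] ne.
      by rewrite -addSn leq_add // ltn_Pdiv // ltn_neqAle eq_sym ne.
    by rewrite -addnS leq_add // ltn_Pdiv // ltn_neqAle eq_sym ne.
  apply: Ifuel; rewrite ?divn_gt0 ?(dvdn_leq _ a1d) ?(dvdn_leq _ a2d) //.
  by rewrite -ltnS prednK // addn_gt0 n1_gt0.
rewrite main; under eq_bigr => a1 _ do rewrite big_split /=.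
rewrite big_split /=.
rewrite (bigD1_seq 1%N) ?divisors_uniq -?dvdn_divisors ?dvd1n //=.
rewrite (bigD1_seq 1%N) ?divisors_uniq -?dvdn_divisors ?dvd1n //=.
rewrite big1 ?addr0 => [|a2 /negPf a21]; last by rewrite /one2 a21.
rewrite big1 ?addr0 => [|a1 /negPf a11]; last by rewrite big1 // => a2 _; rewrite /one2 a11.
have -> : H n1 n2 = (G 1%N 1%N)^-1 * (ddelta2 K n1 n2 -
    \sum_(a1 <- divisors n1) \sum_(a2 <- divisors n2)
      (if one2 a1 a2 then 0 else T a1 a2)).
  by rewrite /H /T; case: n1 n1_gt0 {main T} => // n1 _.
by rewrite mulVKf // subrK.
Qed.

Lemma vartheta_dinverse2_exists (k : nat) (f : 'I_k -> nat -> K) theta :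
  is_vartheta f theta -> exists thetainv, dinverse2 theta thetainv.
Proof. by move=> /is_vartheta11 t11; apply: dinverse2_exists; rewrite t11 oner_neq0. Qed.

End Existence.

(* Main.v *)
(** Both sides of the first identity are multiplicative in [(n1, n2)], so it
    suffices to compare them at pairs of powers of a prime [p]. There
    [h n := F (p ^ n)] is the complete homogeneous symmetric polynomial of the
    [f_i p], whose generating series is inverse to
    [\prod_i (1 - f_i p t) = \sum_d (-1)^d e_d t^d]; this recurrence makes
    [h a h b - \sum_(1 <= i <= a, 1 <= j <= b) (-1)^(i+j) e_(i+j) h (a-i) h (b-j)]
    depend on [a + b] only, hence equal to [h (a + b)]. The second identity
    follows by convolving the first with the inverse of [vartheta_F]. *)

Require Import Defs.
From mathcomp Require Import all_boot all_order all_algebra.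
From mathcomp Require Import reals complex mpoly ring.

Set Implicit Arguments.
Unset Strict Implicit.
Unset Printing Implicit Defensive.

Import GRing.Theory.
Local Open Scope ring_scope.

(** * Sums over divisors *)

Section DivisorSums.

Variable V : nmodType.

(** A divisor [d] of [m * n] factors as [gcdn d m * gcdn d n], and coprimality makes this
    factorisation unique. *)
Lemma perm_divisorsM m n : (0 < m)%N -> (0 < n)%N -> coprime m n ->
  perm_eq (divisors (m * n)) [seq (a * b)%N | a <- divisors m, b <- divisors n].
Proof.
move=> m0 n0 co; have mn0 : (0 < m * n)%N by rewrite muln_gt0 m0.
apply: uniq_perm; first exact: divisors_uniq.
  apply: allpairs_uniq; rewrite ?divisors_uniq // => -[a b] [c d].
  move=> /allpairsP[[x y] /= [+ + [-> ->]]] /allpairsP[[z t] /= [+ + [-> ->]]].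
  rewrite -!dvdn_divisors // => xm yn zm tn e.
  (* The factor dividing [m] is recovered from the product as a gcd, which gives injectivity. *)
  have gcdE u v : (u %| m)%N -> (v %| n)%N -> gcdn (u * v) m = u.
    move=> um vn; rewrite gcdnC Gauss_gcdl; first by apply/gcdn_idPr.
    exact: coprime_dvdr vn co.
  have xz : x = z by rewrite -(gcdE x y) // e gcdE.
  move: e; rewrite xz => /eqP; rewrite eqn_pmul2l; last exact: dvdn_gt0 zm.
  by move=> /eqP ->.
move=> d; rewrite -dvdn_divisors //; apply/idP/allpairsP => [dmn|[[a b] /=]].
  exists (gcdn d m, gcdn d n); rewrite /= -!dvdn_divisors // !dvdn_gcdr.
  split=> //; apply/eqP; rewrite eqn_dvd; apply/andP; split; last first.
    rewrite Gauss_dvd ?dvdn_gcdl //.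
    by apply: coprime_dvdl (dvdn_gcdr _ _) _; apply: coprime_dvdr (dvdn_gcdr _ _) _.
  rewrite muln_gcdr dvdn_gcd dvdn_mull //= muln_gcdl dvdn_gcd dmn andbT.
  exact: dvdn_mulr.
by rewrite -!dvdn_divisors // => -[am bn ->]; apply: dvdn_mul.
Qed.

Lemma sum_divisorsM (g : nat -> V) m n : (0 < m)%N -> (0 < n)%N -> coprime m n ->
  \sum_(d <- divisors (m * n)) g d =
  \sum_(a <- divisors m) \sum_(b <- divisors n) g (a * b)%N.
Proof.
by move=> m0 n0 co; rewrite (perm_big _ (perm_divisorsM m0 n0 co)) big_allpairs_dep.
Qed.

Lemma sum_divisors_pexp (g : nat -> V) p v : prime p ->
  \sum_(d <- divisors (p ^ v)) g d = \sum_(i < v.+1) g (p ^ i)%N.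
Proof.
move=> pp; have p0 := prime_gt0 pp; have p1 := prime_gt1 pp.
rewrite (perm_big [seq (p ^ i)%N | i <- index_iota 0 v.+1]); last first.
  apply: uniq_perm; first exact: divisors_uniq.
    by rewrite map_inj_uniq ?iota_uniq // => i j /eqP; rewrite eqn_exp2l // => /eqP.
  move=> d; rewrite -dvdn_divisors ?expn_gt0 ?p0 //.
  apply/(dvdn_pfactor _ _ pp)/mapP => [[i iv ->]|[i iv ->]].
    by exists i; rewrite // mem_index_iota.
  by exists i => //; rewrite mem_index_iota ltnS in iv.
by rewrite big_map big_mkord.
Qed.

(** Substitution [c = a * b]: both sides run over the pairs with [a * b] dividing [n]. This is what
    makes convolution associative. *)
Lemma sum_divisors_div (g : nat -> nat -> V) n : (0 < n)%N ->
  \sum_(a <- divisors n) \sum_(b <- divisors (n %/ a)) g a b =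
  \sum_(c <- divisors n) \sum_(b <- divisors c) g (c %/ b)%N b.
Proof.
move=> n0.
have dpos a : a \in divisors n -> (0 < a)%N.
  by rewrite -dvdn_divisors //; apply: dvdn_gt0.
(* The dependent inner range becomes a filter on the fixed list [divisors n], so that the two sums
   can be exchanged. *)
transitivity (\sum_(a <- divisors n) \sum_(b <- divisors n | (a * b %| n)%N) g a b).
  apply: eq_big_seq => a ad; have a0 := dpos _ ad.
  move: ad; rewrite -dvdn_divisors // => ad.
  have na0 : (0 < n %/ a)%N by rewrite divn_gt0 ?(dvdn_leq _ ad).
  rewrite -[RHS]big_filter; apply/perm_big/uniq_perm.
  - exact: divisors_uniq.
  - by rewrite filter_uniq ?divisors_uniq.
  move=> b; rewrite mem_filter -!dvdn_divisors // dvdn_divRL // mulnC.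
  by case: (boolP (a * b %| n)%N) => //= /(dvdn_trans (dvdn_mull a (dvdnn b))).
transitivity (\sum_(b <- divisors n) \sum_(c <- divisors n | (b %| c)%N) g (c %/ b)%N b).
  rewrite (exchange_big_dep xpredT) //=; apply: eq_big_seq => b bd.
  have b0 := dpos _ bd; move: bd; rewrite -dvdn_divisors // => bd.
  rewrite -[LHS]big_filter -[RHS]big_filter.
  rewrite (perm_big [seq (c %/ b)%N | c <- [seq c <- divisors n | (b %| c)%N]]).
    by rewrite big_map.
  apply: uniq_perm.
  - by rewrite filter_uniq ?divisors_uniq.
  - rewrite map_inj_in_uniq ?filter_uniq ?divisors_uniq // => c c'.
    rewrite !mem_filter => /andP[bc _] /andP[bc' _] e.
    by rewrite -(divnK bc) e divnK.
  move=> a; rewrite mem_filter -dvdn_divisors //; apply/andP/mapP => [[abn an]|[c]].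
    by exists (a * b)%N; rewrite ?mulnK // mem_filter dvdn_mull // -dvdn_divisors.
  rewrite mem_filter -dvdn_divisors // => /andP[bc cn] ->; rewrite divnK //; split=> //.
  by apply: dvdn_trans cn; apply: dvdn_div.
rewrite (exchange_big_dep xpredT) //=; apply: eq_big_seq => c cd.
have c0 := dpos _ cd; move: cd; rewrite -dvdn_divisors // => cn.
rewrite -[LHS]big_filter; apply/perm_big/uniq_perm.
- by rewrite filter_uniq ?divisors_uniq.
- exact: divisors_uniq.
move=> b; rewrite mem_filter -!dvdn_divisors //.
by case: (boolP (b %| c)%N) => //= /dvdn_trans; apply.
Qed.

End DivisorSums.

(** * Multiplicative functions of two variables *)

Section Multiplicativity.

Variable K : fieldType.

Definition coprime_multiplicative (F : nat -> K) : Prop :=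
  forall m n, (0 < m)%N -> (0 < n)%N -> coprime m n -> F (m * n)%N = F m * F n.

Definition coprime_multiplicative2 (G : nat -> nat -> K) : Prop :=
  forall m1 m2 n1 n2, (0 < m1)%N -> (0 < m2)%N -> (0 < n1)%N -> (0 < n2)%N ->
    coprime (m1 * m2) (n1 * n2) -> G (m1 * n1)%N (m2 * n2)%N = G m1 m2 * G n1 n2.

Lemma divnMM m n a b : (a %| m)%N -> (b %| n)%N -> ((m * n) %/ (a * b) = m %/ a * (n %/ b))%N.
Proof.
case: a => [|a]; first by rewrite dvd0n => /eqP->; rewrite !mul0n div0n.
case: b => [|b]; first by move=> _; rewrite dvd0n => /eqP->; rewrite !muln0.
by move=> am bn; rewrite -{1}(divnK am) -{1}(divnK bn) mulnACA mulnK.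
Qed.

Lemma divisor_div_gt0 n a : (0 < n)%N -> (a %| n)%N -> (0 < n %/ a)%N.
Proof. by move=> n0 an; rewrite divn_gt0 ?(dvdn_leq _ an) // (dvdn_gt0 n0 an). Qed.

Lemma dconv_coprime_multiplicative (f g : nat -> K) :
  coprime_multiplicative f -> coprime_multiplicative g ->
  coprime_multiplicative (dconv f g).
Proof.
move=> fM gM m n m0 n0 co; rewrite /dconv sum_divisorsM // mulr_suml.
apply: eq_big_seq => a; rewrite -dvdn_divisors // => am; rewrite mulr_sumr.
apply: eq_big_seq => b; rewrite -dvdn_divisors // => bn.
rewrite divnMM // fM ?(dvdn_gt0 m0 am) ?(dvdn_gt0 n0 bn) //; last first.
  exact: coprime_dvdl am (coprime_dvdr bn co).
rewrite gM ?divisor_div_gt0 // 1?mulrACA //.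
exact: coprime_dvdl (dvdn_div am) (coprime_dvdr (dvdn_div bn) co).
Qed.

Lemma dconv_fam_coprime_multiplicative k (f : 'I_k -> nat -> K) :
  (forall i, completely_multiplicative (f i)) ->
  coprime_multiplicative (dconv_fam f).
Proof.
move=> fM; apply: (big_ind coprime_multiplicative).
- by move=> m n _ _ _; rewrite /ddelta muln_eq1 -natrM mulnb.
- exact: dconv_coprime_multiplicative.
- by move=> i _ m n m0 n0 _; apply: (fM i).2.
Qed.

Lemma dconv2_coprime_multiplicative2 (G H : nat -> nat -> K) :
  coprime_multiplicative2 G -> coprime_multiplicative2 H ->
  coprime_multiplicative2 (dconv2 G H).
Proof.
move=> GM HM m1 m2 n1 n2 m10 m20 n10 n20 co; rewrite /dconv2.
(* Used for the divisor pairs and their cofactors; with ones in some slots it also yields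
   coprimality in each variable separately. *)
have co_dvd a1 a2 b1 b2 : (a1 %| m1)%N -> (a2 %| m2)%N -> (b1 %| n1)%N -> (b2 %| n2)%N ->
    coprime (a1 * a2) (b1 * b2).
  by move=> *; apply: coprime_dvdl (coprime_dvdr _ co); apply: dvdn_mul.
have co1 : coprime m1 n1.
  by have := co_dvd m1 1%N n1 1%N; rewrite !muln1 => ->.
have co2 : coprime m2 n2.
  by have := co_dvd 1%N m2 1%N n2; rewrite !mul1n => ->.
rewrite sum_divisorsM // mulr_suml; apply: eq_big_seq => a1.
rewrite -dvdn_divisors // => a1m.
under eq_bigr => b1 _ do rewrite sum_divisorsM //.
rewrite exchange_big mulr_suml; apply: eq_big_seq => a2.
rewrite -dvdn_divisors // => a2m; rewrite mulr_sumr.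
apply: eq_big_seq => b1; rewrite -dvdn_divisors // => b1n; rewrite mulr_sumr.
apply: eq_big_seq => b2; rewrite -dvdn_divisors // => b2n.
rewrite !divnMM // GM ?co_dvd //.
- by rewrite HM ?divisor_div_gt0 ?co_dvd ?dvdn_div // mulrACA.
- exact: dvdn_gt0 a1m.
- exact: dvdn_gt0 a2m.
- exact: dvdn_gt0 b1n.
- exact: dvdn_gt0 b2n.
Qed.

(** Strong induction on [n1 * n2]: splitting off the full powers of its least prime factor from both
    arguments leaves coprime cofactors with a smaller product. *)
Lemma coprime_multiplicative2_eq (G H : nat -> nat -> K) :
  coprime_multiplicative2 G -> coprime_multiplicative2 H ->
  (forall p v1 v2, prime p -> G (p ^ v1)%N (p ^ v2)%N = H (p ^ v1)%N (p ^ v2)%N) ->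
  forall n1 n2, (0 < n1)%N -> (0 < n2)%N -> G n1 n2 = H n1 n2.
Proof.
move=> GM HM GH n1 n2; have [N] := ubnP (n1 * n2)%N.
elim: N n1 n2 => // N IH n1 n2; rewrite ltnS => leN n10 n20.
have [n12|n12] := leqP (n1 * n2) 1.
  have : (n1 * n2 == 1)%N by rewrite eqn_leq n12 muln_gt0 n10.
  (* The pair (1, 1) is a pair of zeroth powers of the prime 2. *)
  by rewrite muln_eq1 => /andP[/eqP-> /eqP->]; apply: (GH 2 0 0).
have pp := pdiv_prime n12; set p := pdiv _ in pp; have p0 := prime_gt0 pp.
have [m1 co1 e1] := pfactor_coprime pp n10; have [m2 co2 e2] := pfactor_coprime pp n20.
have m10 : (0 < m1)%N by move: n10; rewrite e1 muln_gt0 => /andP[].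
have m20 : (0 < m2)%N by move: n20; rewrite e2 muln_gt0 => /andP[].
have co : coprime (m1 * m2) (p ^ logn p n1 * p ^ logn p n2).
  by rewrite -expnD coprime_sym coprimeXl // coprimeMr co1.
rewrite e1 e2 GM ?HM ?expn_gt0 ?p0 // GH // IH //.
apply: leq_trans leN; rewrite [in X in (_ < X)%N]e1 [in X in (_ < X)%N]e2 mulnACA.
rewrite -expnD -lognM // ltn_Pmulr ?muln_gt0 ?m10 //.
rewrite -(exp1n (logn p (n1 * n2))) ltn_exp2r ?prime_gt1 //.
by rewrite logn_gt0 mem_primes pp muln_gt0 n10 n20 pdiv_dvd.
Qed.

(** Associativity and commutativity turn [T'] * ([T] * [G]) into ([T] * [T']) * [G], and the unit
    leaves [G]. *)
Lemma dconv2_inverse (T T' G : nat -> nat -> K) : dinverse2 T T' ->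
  forall n1 n2, (0 < n1)%N -> (0 < n2)%N -> dconv2 T' (dconv2 T G) n1 n2 = G n1 n2.
Proof.
move=> TT' n1 n2 n10 n20; rewrite /dconv2.
(* The second variable is regrouped first, by [c2 = a2 * b2]; the first one follows below. *)
transitivity (\sum_(a1 <- divisors n1) \sum_(b1 <- divisors (n1 %/ a1))
   \sum_(c2 <- divisors n2) \sum_(b2 <- divisors c2)
   T' a1 (c2 %/ b2)%N * T b1 b2 * G (n1 %/ (a1 * b1))%N (n2 %/ c2)%N).
  apply: eq_bigr => a1 _; under eq_bigr => a2 _ do rewrite mulr_sumr.
  rewrite exchange_big; apply: eq_bigr => b1 _.
  under eq_bigr => a2 _ do rewrite mulr_sumr.
  rewrite sum_divisors_div //; apply: eq_big_seq => c2.
  rewrite -dvdn_divisors // => c2n; apply: eq_big_seq => b2.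
  rewrite -dvdn_divisors ?(dvdn_gt0 n20 c2n) // => b2c.
  by rewrite mulrA -!divnMA divnK.
rewrite sum_divisors_div //.
transitivity (\sum_(c1 <- divisors n1) \sum_(c2 <- divisors n2)
   ddelta2 K c1 c2 * G (n1 %/ c1)%N (n2 %/ c2)%N).
  apply: eq_big_seq => c1; rewrite -dvdn_divisors // => c1n.
  have c10 := dvdn_gt0 n10 c1n.
  rewrite exchange_big; apply: eq_big_seq => c2; rewrite -dvdn_divisors // => c2n.
  rewrite -TT' ?(dvdn_gt0 n20 c2n) // /dconv2 mulr_suml.
  apply: eq_big_seq => b1; rewrite -dvdn_divisors // => b1c; rewrite mulr_suml.
  by apply: eq_bigr => b2 _; rewrite divnK // [T' _ _ * _]mulrC.
(* Only the term [c1 = c2 = 1] survives. *)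
rewrite (bigD1_seq 1%N) ?divisors_uniq -?dvdn_divisors ?dvd1n //=.
rewrite (bigD1_seq 1%N) ?divisors_uniq -?dvdn_divisors ?dvd1n //=.
rewrite {1}/ddelta2 mul1r !divn1 !big1 ?addr0 // => [a1 /negPf a11|a2 /negPf a21].
  by rewrite big1 // => a2 _; rewrite /ddelta2 a11 mul0r.
by rewrite /ddelta2 a21 mul0r.
Qed.

End Multiplicativity.

(** * Prime powers *)

(** Here [c d] stands for (-1)^d e_d. By induction on [a], one unit moves from [a] to [b]: the
    right-hand side is the same at (a+1, b) and at (a, b+1). *)
Lemma complete_homogeneous_add (R : comNzRingType) (c h : nat -> R) : c 0%N = 1 ->
  (forall n, \sum_(d < n.+1) c d * h (n - d)%N = (n == 0%N)%:R) ->
  forall a b, h (a + b)%N = h a * h b -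
    \sum_(i < a) \sum_(j < b) c (i.+1 + j.+1)%N * (h (a - i.+1)%N * h (b - j.+1)%N).
Proof.
move=> c0 ch.
have h0 : h 0%N = 1 by have := ch 0%N; rewrite big_ord1 c0 mul1r.
(* The recurrence at [n.+1] with its terms [d = 0] and [d = 1] moved to the right. *)
have hS n : \sum_(j < n) c j.+2 * h (n - j.+1)%N = - (h n.+1 + c 1%N * h n).
  have := ch n.+1; rewrite !big_ord_recl /= c0 mul1r subn0 addrA => /eqP.
  rewrite subSS subn0 addrC addr_eq0 => /eqP <-; apply: eq_bigr => j _.
  by rewrite /bump /= !add1n subSS.
move=> a b; elim: a b => [|a IH] b; first by rewrite add0n h0 mul1r big_ord0 subr0.
rewrite addSnnS IH.
(* Splitting off [i = 0] here and [j = 0] in the next sum leaves the same double sum; [hS] evaluates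
   the two boundary sums. *)
have -> : \sum_(i < a.+1) \sum_(j < b)
    c (i.+1 + j.+1)%N * (h (a.+1 - i.+1)%N * h (b - j.+1)%N) =
    h a * - (h b.+1 + c 1%N * h b) + \sum_(i < a) \sum_(j < b)
      c (i.+1 + j.+1).+1 * (h (a - i.+1)%N * h (b - j.+1)%N).
  rewrite big_ord_recl -hS mulr_sumr; congr (_ + _).
  by apply: eq_bigr => j _; rewrite subn1 /= mulrCA.
have -> : \sum_(i < a) \sum_(j < b.+1)
    c (i.+1 + j.+1)%N * (h (a - i.+1)%N * h (b.+1 - j.+1)%N) =
    h b * - (h a.+1 + c 1%N * h a) + \sum_(i < a) \sum_(j < b)
      c (i.+1 + j.+1).+1 * (h (a - i.+1)%N * h (b - j.+1)%N).
  rewrite -hS mulr_sumr -big_split; apply: eq_bigr => i _ /=.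
  rewrite big_ord_recl addn1 subn1 /=; congr (_ + _).
    by rewrite mulrA mulrC.
  by apply: eq_bigr => j _; rewrite /bump add1n subSS addnS.
ring.
Qed.

Section PrimePowers.

Variable K : fieldType.

(** Polynomials taken modulo ['X^N] play the role of power series; this congruence is compatible
    with products. *)
Lemma coefM_congr (N : nat) (A B C : {poly K}) :
  (forall n, (n < N)%N -> A`_n = B`_n) ->
  forall n, (n < N)%N -> (A * C)`_n = (B * C)`_n.
Proof.
move=> AB n nN; rewrite !coefM; apply: eq_bigr => i _.
by rewrite AB // (leq_ltn_trans _ nN) // -ltnS.
Qed.

Lemma completely_multiplicativeX (f : nat -> K) p n :
  completely_multiplicative f -> (0 < p)%N -> f (p ^ n)%N = f p ^+ n.
Proof.
case=> -[m m0 fm] fM p0; elim: n => [|n IH]; last by rewrite expnS fM ?expn_gt0 ?p0 // IH exprS.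
(* The value at 1 is 1, by cancelling the nonzero [f m] in [f 1 * f m = f m]. *)
by apply: (mulIf fm); rewrite -fM // mul1n mul1r.
Qed.

Lemma dconv_pexp (f g : nat -> K) p n : prime p ->
  dconv f g (p ^ n)%N = \sum_(i < n.+1) f (p ^ i)%N * g (p ^ (n - i))%N.
Proof.
move=> pp; rewrite /dconv sum_divisors_pexp //; apply: eq_bigr => i _.
by rewrite -expnB ?prime_gt0 // -ltnS.
Qed.

(* The identity [\prod_i (1 - f_i p X) * \sum_n F (p ^ n) X^n = 1] of formal
   power series, read modulo [X^N]. *)
Lemma dconv_seq_generating (s : seq (nat -> K)) p N : prime p ->
  (forall g, List.In g s -> completely_multiplicative g) ->
  forall n, (n < N)%N ->
    ((\prod_(g <- s) (1 - (g p)%:P * 'X)) *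
      \poly_(i < N) (\big[@dconv K/ddelta K]_(g <- s) g) (p ^ i)%N)`_n = (1 : {poly K})`_n.
Proof.
move=> pp; have p0 := prime_gt0 pp; elim: s => [_|g s IH sM] n nN.
  rewrite !big_nil mul1r coef_poly nN coef1 /ddelta.
  by rewrite -(expn0 p) eqn_exp2l // prime_gt1.
set S := \big[_/_]_(g <- s) g in IH; set E := \prod_(g <- s) _ in IH.
have gM : completely_multiplicative g by apply: sM; left.
have {}IH := IH (fun g' gs => sM g' (or_intror gs)).
pose H (f : nat -> K) := \poly_(i < N) f (p ^ i)%N.
(* At powers of [p], Dirichlet convolution is the Cauchy product of the generating series. *)
have HM m : (m < N)%N -> (H (dconv g S))`_m = (H g * H S)`_m.
  move=> mN; rewrite coef_poly mN dconv_pexp // coefM; apply: eq_bigr => i _.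
  rewrite !coef_poly (leq_ltn_trans (leq_subr _ _) mN).
  by rewrite (leq_ltn_trans (leq_ord i) mN).
(* Complete multiplicativity makes [H g] a truncated geometric series of ratio [g p * X]. *)
have Hg m : (m < N)%N -> ((1 - (g p)%:P * 'X) * H g)`_m = (1 : {poly K})`_m.
  move=> mN; rewrite mulrBl mul1r coefB -mulrA coefCM coefXM coef1 !coef_poly mN.
  rewrite !completely_multiplicativeX //; case: m mN => [|m] mN.
    by rewrite expr0 mulr0 subr0.
  by rewrite /= (ltnW mN) exprS subrr.
rewrite !big_cons -/E -/S -/(H _) [_ * H _]mulrC (coefM_congr _ HM) //.
by rewrite mulrC mulrACA (coefM_congr _ Hg) // mul1r IH.
Qed.

Lemma meval_mesym k d (x : 'I_k -> K) :
  (mesym k K d).@[x] = \sum_(J : {set 'I_k} | #|J| == d) \prod_(i in J) x i.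
Proof.
rewrite /mesym rmorph_sum /=; apply: eq_bigr => J _.
by rewrite rmorph_prod /=; apply: eq_bigr => i _; rewrite mevalXU.
Qed.

(** Vieta: expanding the product, [J] is the set of factors that contribute [- x i * X], so the
    coefficient of degree [d] collects the sets with [d] elements. *)
Lemma coef_prod_1sub k (x : 'I_k -> K) d :
  (\prod_(i < k) (1 - (x i)%:P * 'X))`_d = (-1) ^+ d * (mesym k K d).@[x].
Proof.
under eq_bigr => i _ do rewrite addrC.
rewrite bigA_distr coef_sum meval_mesym mulr_sumr [RHS]big_mkcond /=.
apply: eq_bigr => J _.
rewrite -big_mkcond /=.
under eq_bigr => i _ do rewrite -mulNr -polyCN.
rewrite big_split /= prodr_const -rmorph_prod coefCM coefXn prodrN /= eq_sym.
by case: eqP => [->|_]; rewrite ?mulr1 ?mulr0.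
Qed.

Lemma mesym_gt k d (x : 'I_k -> K) : (k < d)%N -> (mesym k K d).@[x] = 0.
Proof.
move=> kd; rewrite meval_mesym big_pred0 // => J; apply/negbTE.
by rewrite neq_ltn (leq_ltn_trans (max_card _)) // card_ord.
Qed.

Lemma dconv_fam_pexp k (f : 'I_k -> nat -> K) p : prime p ->
  (forall i, completely_multiplicative (f i)) ->
  forall n, \sum_(d < n.+1) (-1) ^+ d * (mesym k K d).@[fun i => f i p] *
              dconv_fam f (p ^ (n - d))%N = (n == 0%N)%:R.
Proof.
move=> pp fM n.
(* The family becomes a list, the form on which the generating identity was proved by induction; the
   truncation [n.+1] just reaches degree [n]. *)
pose s := [seq f i | i <- index_enum 'I_k].
have sM g : List.In g s -> completely_multiplicative g.
  by rewrite /s; elim: (index_enum _) => //= i r IH [<-|/IH].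
have := @dconv_seq_generating s p n.+1 pp sM n (ltnSn n).
rewrite !big_map coef1 coefM => <-; apply: eq_bigr => d _.
by rewrite coef_prod_1sub coef_poly ltnS leq_subr.
Qed.

Lemma vartheta_pp0 k (f : 'I_k -> nat -> K) p v :
  (vartheta_pp f p 0 v.+1 = 0) * (vartheta_pp f p v.+1 0 = 0).
Proof. by []. Qed.

(** One formula covers both cases because e_d vanishes for d > k. *)
Lemma vartheta_ppS k (f : 'I_k -> nat -> K) p i j :
  vartheta_pp f p i.+1 j.+1 =
    - ((-1) ^+ (i.+1 + j.+1) * (mesym k K (i.+1 + j.+1)).@[fun i => f i p]).
Proof.
rewrite /vartheta_pp; have [_|/mesym_gt ->] := leqP (i.+1 + j.+1) k; last first.
  by rewrite andbF mulr0 oppr0.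
by rewrite subn1 addSn /= exprS mulN1r mulNr opprK.
Qed.

(** On exponents, [theta] is 1 at the origin, 0 on the rest of the axes and [- c (i + j)] elsewhere,
    so the convolution is the right-hand side of [complete_homogeneous_add]. *)
Lemma dconv_fam_prime_powers k (f : 'I_k -> nat -> K) theta p v1 v2 : prime p ->
  (forall i, completely_multiplicative (f i)) -> is_vartheta f theta ->
  dconv_fam f (p ^ v1 * p ^ v2)%N =
  dconv2 theta (fun a b => dconv_fam f a * dconv_fam f b) (p ^ v1)%N (p ^ v2)%N.
Proof.
move=> pp fM [_ thetaE]; set F := dconv_fam f.
pose c d : K := (-1) ^+ d * (mesym k K d).@[fun i => f i p].
have c0 : c 0%N = 1 by rewrite /c expr0 mul1r mesym0E meval1.
rewrite -expnD.
rewrite (complete_homogeneous_add (h := fun n => F (p ^ n)%N) c0 (dconv_fam_pexp pp fM)).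
rewrite /dconv2 sum_divisors_pexp // big_ord_recl sum_divisors_pexp // big_ord_recl.
rewrite thetaE // mul1r -addrA; congr (_ + _); first by rewrite expn0 !divn1.
rewrite [X in _ = X + _]big1 ?add0r => [|j _]; last by rewrite thetaE // vartheta_pp0 mul0r.
rewrite -sumrN; apply: eq_bigr => i _.
rewrite sum_divisors_pexp // big_ord_recl thetaE // vartheta_pp0 mul0r add0r.
rewrite -sumrN; apply: eq_bigr => j _.
rewrite thetaE // vartheta_ppS mulNr.
by rewrite !lift0 -!expnB ?prime_gt0.
Qed.

End PrimePowers.

Unset Implicit Arguments.

Theorem theorem2 (R : realType) (k : nat) (f : 'I_k -> nat -> R[i])
    (theta thetainv : nat -> nat -> R[i]) :
  (0 < k)%N ->
  (forall i, completely_multiplicative (f i)) ->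
  is_vartheta f theta ->
  dinverse2 theta thetainv ->
  let F := dconv_fam f in
  forall n1 n2 : nat, (0 < n1)%N -> (0 < n2)%N ->
    F (n1 * n2)%N =
      \sum_(a1 <- divisors n1) \sum_(a2 <- divisors n2)
        F (n1 %/ a1)%N * F (n2 %/ a2)%N * theta a1 a2
    /\
    F n1 * F n2 =
      \sum_(a1 <- divisors n1) \sum_(a2 <- divisors n2)
        F ((n1 * n2) %/ (a1 * a2))%N * thetainv a1 a2.
Proof.
move=> _ fM thetaP thetaK F.
have FM : coprime_multiplicative F by apply: dconv_fam_coprime_multiplicative.
pose G a b := F a * F b.
have first_identity n1 n2 : (0 < n1)%N -> (0 < n2)%N ->
    F (n1 * n2)%N = dconv2 theta G n1 n2.
  apply: (coprime_multiplicative2_eq (G := fun a b => F (a * b)%N)).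
  - move=> m1 m2 n1' n2' m10 m20 n10 n20 co.
    by rewrite mulnACA FM // muln_gt0 ?m10 ?n10.
  - apply: dconv2_coprime_multiplicative2; first exact: thetaP.1.2.
    move=> m1 m2 n1' n2' m10 m20 n10 n20.
    rewrite coprimeMl !coprimeMr => /andP[/andP[co1 _] /andP[_ co2]].
    by rewrite /G !FM // mulrACA.
  - by move=> p v1 v2 pp; apply: dconv_fam_prime_powers.
move=> n1 n2 n10 n20; split.
  rewrite first_identity // /dconv2; apply: eq_bigr => a1 _; apply: eq_bigr => a2 _.
  by rewrite mulrC.
(* [G] is written as [thetainv] * ([theta] * [G]), and the first identity evaluates the inner
   convolution at each cofactor pair. *)
rewrite -[LHS](dconv2_inverse G thetaK n10 n20) {1}/dconv2.
apply: eq_big_seq => a1; rewrite -dvdn_divisors // => a1n.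
apply: eq_big_seq => a2; rewrite -dvdn_divisors // => a2n.
by rewrite -first_identity ?divisor_div_gt0 // divnMM // mulrC.
Qed.
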